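(* For every integer $k\ge 2$ and every positive integer $n$, $$(k-2)\left\lfloor\frac nk\right\rfloor\le \mathrm{co^+ex}(n,J_k)\le \frac{k-2}{k-1}\,n .$$
   Context: A $3$-graph is a finite $3$-uniform hypergraph. $J_k$ is the $3$-graph on $k+1$ vertices with a distinguished vertex $x$ whose $\binom k2$ edges are exactly the triples $\{x,u,v\}$ where $\{u,v\}$ ranges over all pairs of the other $k$ vertices. The minimum positive co-degree $\delta_2^+(H)$ of a non-empty $3$-graph $H$ is the maximum $m$ such that every pair of vertices contained in some edge of $H$ is contained in at least $m$ distinct edges of $H$; by convention it is $0$ if $H$ has no edges. A hypergraph is $F$-free if it has no (not necessarily induced) subhypergraph isomorphic to $F$. $\mathrm{co^+ex}(n,F)$ is the maximum of $\delta_2^+(H)$ over all $n$-vertex $F$-free $3$-graphs $H$. *)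

(* Defs.v *)
From mathcomp Require Import all_boot.

Set Implicit Arguments.
Unset Strict Implicit.
Unset Printing Implicit Defensive.

(* A hypergraph with vertex type V is given by its edge set
   E : {set {set V}}. *)

Definition is_3graph (V : finType) (E : {set {set V}}) : bool :=
  [forall e in E, #|e| == 3].

Definition codegree (V : finType) (E : {set {set V}}) (u v : V) : nat :=
  #|[set e in E | (u \in e) && (v \in e)]|.

Definition positive_pairs_ge (V : finType) (E : {set {set V}}) (m : nat) : bool :=
  [forall u : V, forall v : V,
     (u != v) && [exists e in E, (u \in e) && (v \in e)]
       ==> (m <= codegree E u v)].

(* For a 3-graph with E != set0 some pair lies in an edge, so every admissible m
   is at most #|E|; the range of the maximum therefore loses nothing. *)
Definition min_pos_codegree (V : finType) (E : {set {set V}}) : nat :=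
  if E == set0 then 0
  else \max_(m < #|E|.+1 | positive_pairs_ge E m) m.

(* Subhypergraphs need not be induced: only edges of F must map to edges. *)
Definition contains (W V : finType) (F : {set {set W}}) (E : {set {set V}}) : bool :=
  [exists f : {ffun W -> V},
     injectiveb f && [forall e in F, f @: e \in E]].

Definition F_free (W V : finType) (F : {set {set W}}) (E : {set {set V}}) : bool :=
  ~~ contains F E.

(* Up to isomorphism, every n-vertex 3-graph has vertex type 'I_n.  The maximum
   over an empty family is 0; this does not occur when F has an edge, since then
   set0 is F-free. *)
Definition co_pos_ex (n : nat) (W : finType) (F : {set {set W}}) : nat :=
  \max_(E : {set {set 'I_n}} | is_3graph E && F_free F E) min_pos_codegree E.

(* The distinguished vertex x is None. *)
Definition J (k : nat) : {set {set option 'I_k}} :=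
  [set [set None; Some uv.1; Some uv.2] | uv : 'I_k * 'I_k & uv.1 != uv.2].

(* Main.v *)
(* Upper bound: the link graph of a vertex of a J_k-free 3-graph has no clique
   on k vertices, while each of its non-isolated vertices has degree at least
   the positive co-degree d; if (k-1) d > (k-2) n, then any at most k-1 such
   vertices have a common neighbour, so a clique on k vertices is found greedily.
   Lower bound: colour vertex i by i mod k and take all triples with three
   distinct colours; a copy of J_k would need k+1 distinct colours. *)
Require Import Defs.
From mathcomp Require Import all_boot all_order all_algebra.
From mathcomp Require Import zify.
Import Order.TTheory GRing.Theory Num.Theory.
Local Open Scope ring_scope.

Set Implicit Arguments.
Unset Strict Implicit.
Unset Printing Implicit Defensive.

(** * Upper bound: greedy cliques in the link graph of a vertex *)

(** Union bound: each vertex of [s] rules out at most [#|V| - d] candidates. *)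
Lemma card_common_nbrs (V : finType) (r : rel V) (d : nat) (s : seq V) :
  (forall v, v \in s -> d <= #|[set w | r v w]|)%N ->
  (#|V| <= #|[set w | all (fun v => r v w) s]| + size s * (#|V| - d))%N.
Proof.
elim: s => [|v s IHs] deg.
  by rewrite (_ : [set w | _] = setT) ?cardsT ?addn0 //; apply/setP=> w; rewrite !inE.
have := IHs (fun u su => deg u (mem_behead (s := v :: s) su)).
have := deg v (mem_head _ _).
have := cardsUI [set w | r v w] [set w | all (fun v => r v w) s].
rewrite (_ : _ :&: _ = [set w | all (fun v => r v w) (v :: s)]); last first.
  by apply/setP=> w; rewrite !inE.
have := max_card [set w | r v w].
have := max_card ([set w | r v w] :|: [set w | all (fun v => r v w) s]).
by rewrite /=; lia.
Qed.

(** A clique on at most [k.+1] vertices rules out at most [k.+1 * (#|V| - d)] vertices, and the last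
    hypothesis says that this is less than [#|V|]; so it can be extended. *)
Lemma greedy_clique (V : finType) (r : rel V) (d k : nat) (x y : V) :
  symmetric r -> r x y ->
  (forall v w, r v w -> d <= #|[set u | r v u]|)%N ->
  (k * #|V| < k.+1 * d)%N ->
  exists s : seq V, size s = k.+2 /\ pairwise r s.
Proof.
move=> symr rxy deg lt_kd.
(* The third clause makes [deg] applicable to every vertex of [s]; for a one-vertex clique it does
   not follow from [pairwise]. *)
suff grow j : (j <= k.+1)%N ->
    exists s : seq V, [/\ size s = j.+1, pairwise r s &
                          forall v, v \in s -> exists w, r v w].
  by have [s [? ? _]] := grow _ (leqnn _); exists s.
elim: j => [_|j IHj lt_jk].
  by exists [:: x]; split=> // v /[1!inE] /eqP->; exists y.
have [s [size_s clique_s nbr_s]] := IHj (ltnW lt_jk).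
have deg_s v : v \in s -> (d <= #|[set u | r v u]|)%N.
  by case/nbr_s=> w /deg.
have common := card_common_nbrs deg_s.
have le_dV : (d <= #|V|)%N := leq_trans (deg _ _ rxy) (max_card _).
have V0 : (0 < #|V|)%N by apply/card_gt0P; exists x.
have : (0 < #|[set w | all (fun v => r v w) s]|)%N.
  have : (size s * (#|V| - d) <= k.+1 * (#|V| - d))%N by rewrite leq_mul2r size_s; lia.
  by move: common lt_kd le_dV; rewrite [(k.+1 * (_ - _))%N]mulnBr !mulSn; lia.
case/card_gt0P=> w /[1!inE] /allP common_w.
exists (w :: s); split=> [||v]; rewrite /= ?size_s //.
  by rewrite clique_s andbT; apply/allP=> v /common_w; rewrite symr.
rewrite inE => /predU1P[->|/nbr_s//].
case: s size_s common_w {clique_s nbr_s deg_s common} => // v' s _ /(_ v') rv'.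
by exists v'; rewrite symr rv' ?mem_head.
Qed.

(** Every edge through [x] and [v] is the image of its third vertex [w] under [w] |->
    [[set x; v; w]]. *)
Lemma codegree_le_link (V : finType) (E : {set {set V}}) (x v : V) :
  is_3graph E -> x != v ->
  (codegree E x v <= #|[set w | [set x; v; w] \in E]|)%N.
Proof.
move=> /forallP E3 xv.
apply: leq_trans (leq_imset_card (fun w => [set x; v; w]) _).
apply/subset_leq_card/subsetP=> e /[1!inE] /and3P[Ee xe ve].
have /eqP e3 := implyP (E3 e) Ee.
have sub : [set x; v] \subset e by rewrite subUset !sub1set xe.
have /cards1P[w ew] : #|e :\: [set x; v]| == 1.
  by rewrite cardsD (setIidPr sub) e3 cards2 xv.
have def_e : e = [set x; v; w] by rewrite -[LHS](setID e [set x; v]) (setIidPr sub) ew.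
by apply/imsetP; exists w; rewrite // inE -def_e.
Qed.

Lemma triple_neq (V : finType) (x v w : V) :
  #|[set x; v; w]| = 3 -> [/\ x != v, x != w & v != w].
Proof.
rewrite -setUA cardsU1 cards2 !inE negb_or.
by case: eqP => //=; case: eqP => //=; case: eqP.
Qed.

(** A clique on [k.+2] vertices in the link of [x] is a copy of [J k.+2] with apex [x]. The shift by
    2 keeps truncated subtraction out of the bound. *)
Lemma J_free_codegree_le (V : finType) (E : {set {set V}}) (k : nat) :
  is_3graph E -> F_free (J k.+2) E ->
  (k.+1 * min_pos_codegree E <= k * #|V|)%N.
Proof.
move=> E3 freeE; rewrite /min_pos_codegree.
case: eqP => [_|/eqP/set0Pn[e0 Ee0]]; first by rewrite muln0.
(* Dividing isolates the maximum, so that it suffices to bound each admissible [d]. *)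
rewrite mulnC -leq_divRL //; apply/bigmax_leqP => -[d /= _] /forallP codegE.
rewrite leq_divRL // mulnC leqNgt; apply/negP => lt_d.
have E3' e : e \in E -> #|e| = 3 by move/forallP: E3 => /(_ e)/implyP E3e /E3e/eqP.
have /card_gt0P[x e0x] : (0 < #|e0|)%N by rewrite E3'.
have [y] : exists y, y \in e0 :\ x.
  by apply/card_gt0P; move: (E3' _ Ee0); rewrite (cardsD1 x) e0x; lia.
rewrite !inE => /andP[yx e0y].
(* The link graph of [x]; since edges have three vertices, [r v w] forces [x], [v], [w] to be
   distinct. *)
pose r : rel V := fun v w => [set x; v; w] \in E.
have deg v : x != v -> [exists e in E, (x \in e) && (v \in e)] ->
    (d <= #|[set w | r v w]|)%N.
  move=> xv xvE; apply: leq_trans (codegree_le_link E3 xv).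
  by have /forallP/(_ v) := codegE x; rewrite xv xvE.
(* The strict inequality [lt_d] forces [d] to be positive, so [y] has a neighbour in the link. *)
have [w rw] : exists w, r y w.
  have : (0 < #|[set w | r y w]|)%N.
    apply: leq_trans (deg y _ _); last 2 first.
    - by rewrite eq_sym.
    - by apply/existsP; exists e0; rewrite Ee0 e0x.
    by case: (d) lt_d; rewrite ?muln0.
  by case/card_gt0P=> w /[1!inE]; exists w.
have symr : symmetric r by move=> u v; rewrite /r -!setUA (setUC [set u]).
have rdeg v u : r v u -> (d <= #|[set w | r v w]|)%N.
  move=> rvu; have [xv _ _] := triple_neq (E3' _ rvu).
  apply: deg => //; apply/existsP; exists [set x; v; u].
  by rewrite (rvu : [set x; v; u] \in E) !inE !eqxx !orbT.
have [s [size_s clique_s]] := greedy_clique symr rw rdeg lt_d.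
have rs i j : (i < k.+2)%N -> (j < k.+2)%N -> i != j -> r (nth x s i) (nth x s j).
  move/pairwiseP: clique_s => /(_ x) ltr hi hj; rewrite neq_ltn => /orP[]lt_ij.
    by apply: ltr; rewrite ?inE ?size_s.
  by rewrite symr; apply: ltr; rewrite ?inE ?size_s.
have xs i : (i < k.+2)%N -> x != nth x s i.
  move=> hi; have [j hj ij] : exists2 j, (j < k.+2)%N & i != j.
    (* The boolean is read as a number: index 1 if [i] is 0, and index 0 otherwise. *)
    by exists (i == 0); [case: eqP | case: i hi].
  by have [] := triple_neq (E3' _ (rs _ _ hi hj ij)).
move/negP: freeE; apply; apply/existsP.
exists [ffun o : option 'I_k.+2 => if o is Some i then nth x s i else x].
apply/andP; split.
  apply/injectiveP=> -[i|] [j|]; rewrite !ffunE //.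
  - case: (eqVneq i j) => [->//|ij] eq_ij.
    have [_ _] := triple_neq (E3' _ (rs _ _ (ltn_ord i) (ltn_ord j) ij)).
    by rewrite eq_ij eqxx.
  - by move=> eqx; have := xs _ (ltn_ord i); rewrite eqx eqxx.
  - by move=> eqx; have := xs _ (ltn_ord j); rewrite -eqx eqxx.
apply/forallP=> e; apply/implyP=> /imsetP[[i j] /= /[1!inE] /= ij ->].
by rewrite !imsetU !imset_set1 !ffunE; apply: rs.
Qed.

(** * Lower bound: balanced complete multipartite 3-graphs *)

(** The complete multipartite 3-graph whose parts are the fibres of [c]. *)
Definition rainbow_triples (V C : finType) (c : V -> C) : {set {set V}} :=
  [set e : {set V} | (#|e| == 3) && (#|c @: e| == 3)].

Lemma rainbow_tripleE (V C : finType) (c : V -> C) (x v w : V) :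
  ([set x; v; w] \in rainbow_triples c) = [&& c x != c v, c x != c w & c v != c w].
Proof.
rewrite inE !imsetU !imset_set1; apply/andP/and3P=> [[_ /eqP/triple_neq[]]//|].
case=> xv xw vw; have neq (a b : V) : c a != c b -> a != b by apply: contraNneq => ->.
by rewrite -!setUA !cardsU1 !cards1 !inE !negb_or xv xw vw !neq.
Qed.

(** Any two vertices of [J k] share an edge (for the apex and another vertex, by [2 <= k]), so [c]
    would be injective on a copy. *)
Lemma rainbow_triples_J_free (V : finType) (k : nat) (c : V -> 'I_k) :
  (2 <= k)%N -> F_free (J k) (rainbow_triples c).
Proof.
move=> k2; apply/negP=> /existsP[f /andP[_ /forallP fE]].
have rainbow (i j : 'I_k) : i != j ->
    [&& c (f None) != c (f (Some i)), c (f None) != c (f (Some j))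
      & c (f (Some i)) != c (f (Some j))].
  move=> ij; rewrite -rainbow_tripleE.
  have /implyP := fE [set None; Some i; Some j]; rewrite !imsetU !imset_set1.
  by apply; apply/imsetP; exists (i, j); rewrite ?inE.
have apex (i : 'I_k) : c (f None) != c (f (Some i)).
  have [j ij] : exists j, j != i.
    have : (0 < #|[set~ i]|)%N by rewrite cardsC1 card_ord; lia.
    by case/card_gt0P=> j /[!inE] ji; exists j.
  by case/and3P: (rainbow j i ij).
have /leq_card : injective (c \o f).
  move=> [i|] [j|] //= eq_c.
  - by case: (eqVneq i j) => [->//|/rainbow]; rewrite eq_c eqxx !andbF.
  - by have := apex i; rewrite eq_c eqxx.
  - by have := apex j; rewrite eq_c eqxx.
by rewrite card_option card_ord ltnn.
Qed.

(** Each colour other than those of [u] and [v] offers [t] vertices completing the pair to an edge;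
    pairs (colour, index) inject into these edges. *)
Lemma rainbow_codegree_ge (V C : finType) (c : V -> C) (t : nat) (u v : V) :
  (forall a, exists2 g : 'I_t -> V, injective g & forall q, c (g q) = a) ->
  c u != c v ->
  ((#|C| - 2) * t <= codegree (rainbow_triples c) u v)%N.
Proof.
move=> /fin_all_exists2[g g_inj cg] uv.
pose D := setX (~: [set c u; c v]) [set: 'I_t].
have -> : ((#|C| - 2) * t = #|D|)%N.
  by rewrite cardsX cardsT card_ord cardsCs setCK cards2 uv.
have Dne p : p \in D -> (c u != p.1) && (c v != p.1).
  by rewrite !inE andbT negb_or ![p.1 == _]eq_sym.
(* Deleting [u] and [v] recovers the third vertex, whose colour gives [p.1]; injectivity of [g p.1]
   then gives [p.2]. *)
have Dg p : p \in D -> [set u; v; g p.1 p.2] :\: [set u; v] = [set g p.1 p.2].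
  move/Dne=> /andP[up vp]; apply/setP=> z; rewrite !inE.
  case: (eqVneq z u) => [->|_] /=.
    by apply/esym; apply: contraNF up => /eqP->; rewrite cg.
  case: (eqVneq z v) => [->|_] //=.
  by apply/esym; apply: contraNF vp => /eqP->; rewrite cg.
rewrite -(card_in_imset (f := fun p => [set u; v; g p.1 p.2])); last first.
  move=> p q Dp Dq /(congr1 (fun e => e :\: [set u; v])).
  rewrite !Dg // => /set1_inj.
  case: p q {Dp Dq} => [a i] [b j] /= eq_g.
  by have ab : a = b; [rewrite -(cg a i) eq_g cg | case: _ / ab eq_g => /g_inj->].
apply/subset_leq_card/subsetP=> _ /imsetP[p Dp ->].
rewrite inE rainbow_tripleE !cg uv !inE !eqxx !orbT /=.
by have /andP[-> ->] := Dne p Dp.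
Qed.

(** A pair inside an edge shows [m <= #|E|], so [m] lies in the range of the maximum. *)
Lemma min_pos_codegree_ge (V : finType) (E : {set {set V}}) (m : nat) :
  is_3graph E -> E != set0 -> positive_pairs_ge E m ->
  (m <= min_pos_codegree E)%N.
Proof.
move=> /forallP E3 E0 Em; rewrite /min_pos_codegree (negPf E0).
case/set0Pn: E0 => e Ee; have /eqP e3 := implyP (E3 e) Ee.
have /card_gt1P[u [v [eu ev uv]]] : (1 < #|e|)%N by rewrite e3.
have le_mE : (m < #|E|.+1)%N.
  rewrite ltnS; have /forallP/(_ u)/forallP/(_ v) := Em.
  have -> : [exists e in E, (u \in e) && (v \in e)].
    by apply/existsP; exists e; rewrite Ee eu.
  rewrite uv => /leq_trans; apply; apply/subset_leq_card/subsetP=> f.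
  by rewrite inE => /andP[].
exact: (leq_bigmax_cond (Ordinal le_mE)).
Qed.

Lemma co_pos_ex_J_ge (k n : nat) :
  (2 <= k)%N -> ((k - 2) * (n %/ k) <= co_pos_ex n (J k))%N.
Proof.
case: k => // k hk; pose c (i : 'I_n) : 'I_k.+1 := inord (i %% k.+1).
have val_c i : c i = (i %% k.+1)%N :> nat by rewrite inordK // ltn_mod.
(* If the bound is nonzero, there are at least three colours and no class is empty, so a rainbow
   triple exists. *)
have [->//|] := posnP ((k.+1 - 2) * (n %/ k.+1)).
rewrite muln_gt0 => /andP[k3 t0].
have Erainbow : is_3graph (rainbow_triples c).
  by apply/forallP=> e; apply/implyP; rewrite inE => /andP[].
apply: (@leq_trans (min_pos_codegree (rainbow_triples c))); last first.
  by apply: leq_bigmax_cond; rewrite Erainbow rainbow_triples_J_free.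
(* Class [a] contains the vertices [q * k.+1 + a] for [q < n %/ k.+1]. *)
have classes a : exists2 g : 'I_(n %/ k.+1) -> 'I_n, injective g & forall q, c (g q) = a.
  have lt_n (q : 'I_(n %/ k.+1)) : (q * k.+1 + a < n)%N.
    have : (q.+1 * k.+1 <= n)%N by rewrite -leq_divRL.
    by have := ltn_ord a; rewrite mulSn; lia.
  exists (fun q => Ordinal (lt_n q)) => [p q [/eqP]|q].
    by rewrite eqn_add2r eqn_mul2r => /eqP/val_inj.
  by apply: val_inj; rewrite /= val_c modnMDl modn_small.
apply: min_pos_codegree_ge => //; last first.
  apply/forallP=> u; apply/forallP=> v; apply/implyP=> /andP[uv].
  case/existsP=> e /and3P[/[1!inE] /andP[/eqP e3 /eqP ce3] eu ev].
  rewrite -[X in (X - 2)%N]card_ord; apply: rainbow_codegree_ge => //.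
  (* The colouring is injective on a rainbow edge, so [u] and [v] differ in colour. *)
  have /imset_injP c_inj : #|c @: e| == #|e| by rewrite e3 ce3.
  by apply: contra_neq uv => /c_inj; apply.
have pick a : exists i, c i = a.
  by have [g _ cg] := classes a; exists (g (Ordinal t0)).
have [[x cx] [y cy]] := (pick (inord 0), pick (inord 1)).
have [z cz] := pick (inord 2).
apply/set0Pn; exists [set x; y; z]; rewrite rainbow_tripleE cx cy cz.
by rewrite -!val_eqE /= !inordK; lia.
Qed.

Theorem theorem16 (k n : nat) (hk : (2 <= k)%N) (hn : (0 < n)%N) :
  ((k - 2) * (n %/ k) <= co_pos_ex n (J k))%N /\
  (co_pos_ex n (J k))%:R <= (k%:R - 2) / (k%:R - 1) * n%:R :> rat.
Proof.
split; first exact: co_pos_ex_J_ge.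
case: k hk => [|[|k]] // _.
(* The bound is proved without denominators in [nat], then transferred to [rat]. *)
have le_co : (co_pos_ex n (J k.+2) * k.+1 <= k * n)%N.
  rewrite -leq_divRL //; apply/bigmax_leqP=> E /andP[E3 freeE].
  by have := J_free_codegree_le E3 freeE; rewrite card_ord leq_divRL // mulnC.
have -> : k.+2%:R - 2 = k%:R :> rat by rewrite -natrB // subn2.
have -> : k.+2%:R - 1 = k.+1%:R :> rat by rewrite -natr1 addrK.
by rewrite mulrAC ler_pdivlMr ?ltr0n // -!natrM ler_nat.
Qed.
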